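(* Let $D$ be a finite set, $\gamma,\gamma_*:D\to\mathbb{R}^d$ maps, $\lambda_i,\lambda_i^*\in\mathbb{R}^d$ and $\beta_i,\beta_i^*\in\mathbb{R}$ for $1\le i\le n$. Define the affine logits $s_i(x)=\langle\gamma(x),\lambda_i\rangle+\beta_i$ and $s_i^*(x)=\langle\gamma_*(x),\lambda_i^*\rangle+\beta_i^*$, and the augmented vectors $\tilde\gamma(x)=(\gamma(x),1)$, $\tilde\gamma_*(x)=(\gamma_*(x),1)$, $\tilde\lambda_i=(\lambda_i,\beta_i)$, $\tilde\lambda_i^*=(\lambda_i^*,\beta_i^* )$ in $\mathbb{R}^{d+1}$. Suppose there are maps $\tilde g,\tilde f$ with values in $\mathbb{R}^{d+1}$ with $\tilde\gamma_*(x)=\tilde g(\tilde\gamma(x))$ for all $x\in D$ and $\tilde\lambda_i^*=\tilde f(\tilde\lambda_i)$ for all $i$, and that $\{\tilde\gamma(x):x\in D\}$ spans $\mathbb{R}^{d+1}$. (a) (Exact affine logits.) Assume $\{\tilde\lambda_1,\dots,\tilde\lambda_n\}$ spans $\mathbb{R}^{d+1}$, that there exist $d+1$ linearly independent vectors among the $\tilde\lambda_i$ whose images under $\tilde f$ are linearly independent, and that $s_i^*(x)=s_i(x)$ for all $x\in D$ and all $i$. Then there exist $A\in\operatorname{GL}(d,\mathbb{R})$ and $b\in\mathbb{R}^d$ such that, for all $x\in D$ and all $i$, $$\gamma_*(x)=A^{-\top}\gamma(x)+b,\qquad \lambda_i^*=A\lambda_i,\qquad \beta_i^*=\beta_i-\langle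 A\lambda_i,b\rangle.$$ (b) (Softmax heads.) Assume $\{\tilde\lambda_i-\tilde\lambda_1:2\le i\le n\}$ and $\{\tilde\lambda_i^*-\tilde\lambda_1^*:2\le i\le n\}$ each span $\mathbb{R}^{d+1}$, and that $e^{s_i^*(x)}/\sum_j e^{s_j^*(x)}=e^{s_i(x)}/\sum_j e^{s_j(x)}$ for all $x\in D$ and all $i$. Then there exist $A\in\operatorname{GL}(d,\mathbb{R})$, $b\in\mathbb{R}^d$ and $(\bar c,\tau)\in\mathbb{R}^d\times\mathbb{R}$ such that, for all $x\in D$ and all $i$, $$\gamma_*(x)=A^{-\top}\gamma(x)+b,\qquad \lambda_i^*=A\lambda_i+\bar c,\qquad \beta_i^*=\beta_i-\langle A\lambda_i,b\rangle+\tau;$$ the shift $(\bar c,\tau)$ adds the same quantity $\langle\bar c,\gamma_*(x)\rangle+\tau$ to every class logit, i.e. $s_i^*(x)=s_i(x)+\langle\bar c,\gamma_*(x)\rangle+\tau$.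
   Context: $\langle\cdot,\cdot\rangle$ is the Euclidean inner product. *)

(* Defs.v *)
From HB Require Import structures.
From mathcomp Require Import all_boot all_order all_algebra.
From mathcomp Require Import all_classical all_reals all_analysis.

Set Implicit Arguments.
Unset Strict Implicit.
Unset Printing Implicit Defensive.

Import GRing.Theory.
Local Open Scope ring_scope.

Definition dotp (R : realType) (d : nat) (u v : 'cV[R]_d) : R :=
  \sum_(k < d) u k 0 * v k 0.

(* The augmented vector (u, t) of R^(d+1). *)
Definition augment (R : realType) (d : nat) (u : 'cV[R]_d) (t : R) :
    'cV[R]_(d + 1) :=
  col_mx u (const_mx t).

Definition logit (R : realType) (D : Type) (d n : nat)
    (gamma : D -> 'cV[R]_d) (lambda : 'I_n -> 'cV[R]_d) (beta : 'I_n -> R)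
    (x : D) (i : 'I_n) : R :=
  dotp (gamma x) (lambda i) + beta i.

Definition softmax (R : realType) (n : nat) (s : 'I_n -> R) (i : 'I_n) : R :=
  expR (s i) / \sum_(j < n) expR (s j).

(* Main.v *)
(* The augmented logits are a bilinear pairing <q_x, w_i> = <p_x, v_i> of
   spanning families.  Since the w_i span, q_x = M p_x for a fixed matrix M;
   since the p_x span, v_i = M^T w_i; since the v_i span, M is invertible.  The
   last coordinates of p_x and q_x are all 1, so the last row of M is (0, 1),
   i.e. M = [B b; 0 1], and A is the inverse transpose of B.  For softmax heads
   the same argument applies to the differences with the first class, because
   softmax determines the logits up to a common shift. *)

Require Import Defs.
From HB Require Import structures.
From mathcomp Require Import all_boot all_order all_algebra.
From mathcomp Require Import all_classical all_reals all_analysis.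
From mathcomp Require Import lra.

Set Implicit Arguments.
Unset Strict Implicit.
Unset Printing Implicit Defensive.

Import Order.TTheory GRing.Theory Num.Theory.
Local Open Scope ring_scope.

Lemma dotpE (R : realType) d (u v : 'cV[R]_d) : dotp u v = (v^T *m u) 0 0.
Proof. by rewrite mxE; apply: eq_bigr => k _; rewrite mxE mulrC. Qed.

Lemma dotpC (R : realType) d (u v : 'cV[R]_d) : dotp u v = dotp v u.
Proof. by apply: eq_bigr => k _; rewrite mulrC. Qed.

Lemma dotpDl (R : realType) d (u v w : 'cV[R]_d) :
  dotp (u + v) w = dotp u w + dotp v w.
Proof. by rewrite !dotpE mulmxDr mxE. Qed.

Lemma dotpBl (R : realType) d (u v w : 'cV[R]_d) :
  dotp (u - v) w = dotp u w - dotp v w.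
Proof. by rewrite !dotpE mulmxBr !mxE. Qed.

Lemma dotpBr (R : realType) d (u v w : 'cV[R]_d) :
  dotp u (v - w) = dotp u v - dotp u w.
Proof. by rewrite ![dotp u _]dotpC dotpBl. Qed.

Lemma dotp_mulmxl (R : realType) d (B : 'M[R]_d) (u v : 'cV[R]_d) :
  dotp (B *m u) v = dotp u (B^T *m v).
Proof. by rewrite !dotpE trmx_mul trmxK mulmxA. Qed.

Lemma augmentB (R : realType) d (u v : 'cV[R]_d) (s t : R) :
  augment u s - augment v t = augment (u - v) (s - t).
Proof.
by rewrite /augment opp_col_mx add_col_mx; congr col_mx; apply/matrixP=> i j;
   rewrite !mxE.
Qed.

Lemma dotp_augment (R : realType) d (u v : 'cV[R]_d) (s t : R) :
  dotp (augment u s) (augment v t) = dotp u v + s * t.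
Proof.
rewrite /dotp big_split_ord /= big_ord1 /augment !col_mxEd !mxE.
by congr (_ + _); apply: eq_bigr => k _; rewrite !col_mxEu.
Qed.

Lemma span_full_subset (K : fieldType) (vT : vectType K) (X Y : seq vT) :
  {subset X <= Y} -> <<X>>%VS = fullv -> <<Y>>%VS = fullv.
Proof.
by move=> /sub_span sXY X1; apply/eqP; rewrite eqEsubv subvf -X1.
Qed.

Lemma free_span_full (K : fieldType) (vT : vectType K) (X : seq vT) :
  free X -> size X = \dim {:vT} -> <<X>>%VS = fullv.
Proof.
by move=> /eqP fX sX; apply/eqP; rewrite eqEdim subvf fX sX leqnn.
Qed.

(** Passing to [linfun] extends the agreement from the family to its span, hence to each
    [delta_mx j 0], where the products are the columns of [B] and [C]. *)
Lemma span_full_mulmx_inj (K : fieldType) (I : finType) m p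
    (v : I -> 'cV[K]_m) (B C : 'M[K]_(p, m)) :
  <<[seq v i | i : I]>>%VS = fullv ->
  (forall i, B *m v i = C *m v i) -> B = C.
Proof.
move=> v1 eqBC.
have /span_lfunP eqBCs : {in [seq v i | i : I],
    linfun (mulmx B : 'cV[K]_m -> 'cV[K]_p) =1 linfun (mulmx C)}.
  by move=> _ /codomP[i ->]; rewrite !lfunE /= eqBC.
apply/trmx_inj/row_matrixP => j; apply: trmx_inj.
rewrite !tr_row !trmxK !colE.
by have := eqBCs (delta_mx j 0); rewrite v1 memvf !lfunE; apply.
Qed.

(** The left kernel of the transposed matrix kills every [v i], so it agrees with 0 on a spanning
    family and vanishes. *)
Lemma span_full_row_full (K : fieldType) n m (v : 'I_n -> 'cV[K]_m) :
  <<[seq v i | i : 'I_n]>>%VS = fullv -> row_full (\matrix_i (v i)^T).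
Proof.
move=> v1; rewrite -[row_full _]/(_ == _) -mxrank_tr.
rewrite -[_ == _]/(row_free _) -kermx_eq0; apply/eqP.
apply: (span_full_mulmx_inj v1) => i; rewrite mul0mx.
have /(congr1 (col i)) := mulmx_ker (\matrix_i (v i)^T)^T.
by rewrite col0 colE -mulmxA -colE -tr_row rowK trmxK.
Qed.

Lemma bilinear_gauge (R : realType) (D : finType) m n
    (p q : D -> 'cV[R]_m) (v w : 'I_n -> 'cV[R]_m) :
  <<[seq p x | x : D]>>%VS = fullv ->
  <<[seq v i | i : 'I_n]>>%VS = fullv ->
  <<[seq w i | i : 'I_n]>>%VS = fullv ->
  (forall x i, dotp (q x) (w i) = dotp (p x) (v i)) ->
  exists M : 'M[R]_m, [/\ M \in unitmx, forall x, q x = M *m p x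
                        & forall i, v i = M^T *m w i].
Proof.
move=> p1 /span_full_row_full vfull /span_full_row_full wfull qwpv.
set V := \matrix_i _ in vfull; set W := \matrix_i _ in wfull.
have WqVp x : W *m q x = V *m p x.
  apply/row_matrixP => i; rewrite !row_mul !rowK.
  by apply/matrixP => a b; rewrite !ord1 -!dotpE qwpv.
(* As [W] has full row rank, [pinvmx W] is a left inverse of it, and [W *m q x = V *m p x] can be
   solved for [q x]. *)
pose M := pinvmx W *m V.
have qM x : q x = M *m p x by rewrite -mulmxA -WqVp mulmxA mulVpmx ?mul1mx.
have WM : W *m M = V.
  by apply: (span_full_mulmx_inj p1) => x; rewrite -mulmxA -qM WqVp.
exists M; split=> //.
  (* [V = W *m M] has rank [m], and the rank of a product is at most that of its right factor
     [M]. *)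
  rewrite -row_full_unit -col_leq_rank.
  by rewrite -[X in (X <= _)%N](eqP vfull) -WM mxrankM_maxr.
move=> i; have /(congr1 (row i)) := WM.
by rewrite row_mul !rowK => /(congr1 trmx); rewrite trmx_mul !trmxK.
Qed.

Lemma affine_logits_gauge (R : realType) (D : finType) d n
    (gamma gammas : D -> 'cV[R]_d) (lambda lambdas : 'I_n -> 'cV[R]_d)
    (beta betas : 'I_n -> R) :
  <<[seq augment (gamma x) 1 | x : D]>>%VS = fullv ->
  <<[seq augment (lambda i) (beta i) | i : 'I_n]>>%VS = fullv ->
  <<[seq augment (lambdas i) (betas i) | i : 'I_n]>>%VS = fullv ->
  (forall x i, logit gammas lambdas betas x i = logit gamma lambda beta x i) ->
  exists (A : 'M[R]_d) (b : 'cV[R]_d),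
    [/\ A \in unitmx, forall x, gammas x = (invmx A)^T *m gamma x + b,
        forall i, lambdas i = A *m lambda i
      & forall i, betas i = beta i - dotp (A *m lambda i) b].
Proof.
move=> gamma1 lambda1 lambdas1 eq_logit.
have [x i|M [Munit qM vM]] :=
    bilinear_gauge (q := fun x => augment (gammas x) 1) gamma1 lambda1 lambdas1.
  by rewrite !dotp_augment !mul1r; exact: eq_logit.
(* Both rows send each spanning vector [augment (gamma x) 1] to 1. *)
have Mlast : dsubmx M = row_mx 0 1%:M.
  apply: (span_full_mulmx_inj gamma1) => x.
  rewrite mul_dsub_mx -qM /augment col_mxKd mul_row_col mul0mx add0r.
  by rewrite mul1mx.
pose B := ulsubmx M; pose b := ursubmx M.
have MB : M = block_mx B b 0 1%:M.
  by rewrite -[LHS]vsubmxK Mlast -[usubmx M]hsubmxK.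
have Bunit : B \in unitmx.
  by move: Munit; rewrite MB !unitmxE det_ublock det1 mulr1.
(* These are the two block rows of [vM], the transpose of [M] being lower triangular with blocks
   [B^T], 0, [b^T], 1. *)
have lambdaB i : lambda i = B^T *m lambdas i /\
    beta i = dotp (lambdas i) b + betas i.
  have := vM i; rewrite MB /augment tr_block_mx mul_block_col trmx0 mul0mx.
  rewrite addr0 trmx1 mul1mx => /eq_col_mx[-> /matrixP/(_ 0 0) betaE].
  by split=> //; move: betaE; rewrite mxE [RHS]mxE [X in _ + X]mxE dotpE.
exists (invmx B)^T, b; have lambdasB i : lambdas i = (invmx B)^T *m lambda i.
  by rewrite (lambdaB i).1 mulmxA -trmx_mul mulmxV // trmx1 mul1mx.
split=> //; first by rewrite unitmx_tr unitmx_inv.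
- move=> x; rewrite trmx_inv trmxK invmxK.
  have := qM x; rewrite MB /augment mul_block_col => /eq_col_mx[-> _].
  by rewrite [const_mx 1]mx11_scalar mxE mulmx1.
- by move=> i; rewrite -lambdasB (lambdaB i).2 addrC addKr.
Qed.

(** The normalising sum cancels in the ratio of two softmax values, leaving [expR (u i - u j)], and
    [expR] is injective. *)
Lemma softmax_eq_sub (R : realType) n (s t : 'I_n -> R) :
  softmax s =1 softmax t -> forall i j, s i - s j = t i - t j.
Proof.
move=> st i j.
have sum_neq0 (u : 'I_n -> R) : \sum_(k < n) expR (u k) != 0.
  rewrite lt0r_neq0 // (bigD1 i) //= ltr_wpDr ?expR_gt0 //.
  by apply: sumr_ge0 => k _; exact: expR_ge0.
have ratio (u : 'I_n -> R) : expR (u i - u j) = softmax u i / softmax u j.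
  by rewrite expRB /softmax invf_div mulrA divfK.
by apply: expR_inj; rewrite !ratio !st.
Qed.

Theorem corollaryB7 (R : realType) (D : finType) (d n : nat) (hn : (0 < n)%N)
    (gamma gammas : D -> 'cV[R]_d)
    (lambda lambdas : 'I_n -> 'cV[R]_d)
    (beta betas : 'I_n -> R)
    (g f : 'cV[R]_(d + 1) -> 'cV[R]_(d + 1)) :
  let i1 : 'I_n := Ordinal hn in
  let s := logit gamma lambda beta in
  let ss := logit gammas lambdas betas in
  let tgamma (x : D) := augment (gamma x) 1 in
  let tgammas (x : D) := augment (gammas x) 1 in
  let tlambda (i : 'I_n) := augment (lambda i) (beta i) in
  let tlambdas (i : 'I_n) := augment (lambdas i) (betas i) in
  (forall x : D, tgammas x = g (tgamma x)) ->
  (forall i : 'I_n, tlambdas i = f (tlambda i)) ->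
  <<[seq tgamma x | x : D]>>%VS = fullv ->
  (* (a) *)
  (<<[seq tlambda i | i : 'I_n]>>%VS = fullv ->
   (exists k : 'I_(d + 1) -> 'I_n,
      free [seq tlambda (k j) | j : 'I_(d + 1)] /\
      free [seq f (tlambda (k j)) | j : 'I_(d + 1)]) ->
   (forall (x : D) (i : 'I_n), ss x i = s x i) ->
   exists (A : 'M[R]_d) (b : 'cV[R]_d),
     A \in unitmx /\
     forall (x : D) (i : 'I_n),
       [/\ gammas x = (invmx A)^T *m gamma x + b,
           lambdas i = A *m lambda i
         & betas i = beta i - dotp (A *m lambda i) b])
  /\
  (* (b) *)
  (<<[seq tlambda i - tlambda i1 | i : 'I_n in predC1 i1]>>%VS = fullv ->
   <<[seq tlambdas i - tlambdas i1 | i : 'I_n in predC1 i1]>>%VS = fullv ->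
   (forall (x : D) (i : 'I_n), softmax (ss x) i = softmax (s x) i) ->
   exists (A : 'M[R]_d) (b cbar : 'cV[R]_d) (tau : R),
     A \in unitmx /\
     forall (x : D) (i : 'I_n),
       [/\ gammas x = (invmx A)^T *m gamma x + b,
           lambdas i = A *m lambda i + cbar,
           betas i = beta i - dotp (A *m lambda i) b + tau
         & ss x i = s x i + dotp cbar (gammas x) + tau]).
Proof.
move=> i1 s ss tgamma tgammas tlambda tlambdas _ tlambdasE tgamma1; split.
  move=> tlambda1 [k [_ freek]] eq_logit.
  (* The [d + 1] free images under [f] span by dimension count, and each of them is some
     [tlambdas i]. *)
  have tlambdas1 : <<[seq tlambdas i | i : 'I_n]>>%VS = fullv.
    apply: span_full_subset (free_span_full freek _).
      by move=> _ /codomP[j ->]; rewrite -tlambdasE codom_f.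
    by rewrite size_map -cardE card_ord dimvf /dim /= muln1.
  have [A [b [Aunit gammasE lambdasE betasE]]] :=
    affine_logits_gauge tgamma1 tlambda1 tlambdas1 eq_logit.
  by exists A, b; split.
move=> dlambda1 dlambdas1 eq_softmax.
(* Indexing over all classes only adds the zero difference at [i1]; the differences are again
   augmented vectors, as [affine_logits_gauge] requires. *)
have full_diff (mu : 'I_n -> 'cV[R]_d) (c : 'I_n -> R) :
    let v i := augment (mu i) (c i) in
    <<[seq v i - v i1 | i : 'I_n in predC1 i1]>>%VS = fullv ->
    <<[seq augment (mu i - mu i1) (c i - c i1) | i : 'I_n]>>%VS = fullv.
  by move=> v; apply: span_full_subset => _ /mapP[i _ ->];
    rewrite /v augmentB codom_f.
have eq_logit x i :
    logit gammas (fun i => lambdas i - lambdas i1)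
      (fun i => betas i - betas i1) x i =
    logit gamma (fun i => lambda i - lambda i1) (fun i => beta i - beta i1) x i.
  have := softmax_eq_sub (eq_softmax x) i i1.
  by rewrite /s /ss /logit !dotpBr; lra.
have [A [b [Aunit gammasE dlambdasE dbetasE]]] :=
  affine_logits_gauge tgamma1 (full_diff _ _ dlambda1) (full_diff _ _ dlambdas1)
    eq_logit.
(* [cbar] and [tau] are forced by the required formulas at [i1]; the difference formulas carry them
   to every other class. *)
pose cbar := lambdas i1 - A *m lambda i1.
pose tau := betas i1 - beta i1 + dotp (A *m lambda i1) b.
exists A, b, cbar, tau; split=> // x i.
have lambdasE : lambdas i = A *m lambda i + cbar.
  have /eqP := dlambdasE i; rewrite mulmxBr subr_eq => /eqP ->.
  by rewrite /cbar addrA addrAC.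
have betasE : betas i = beta i - dotp (A *m lambda i) b + tau.
  by have := dbetasE i; rewrite mulmxBr dotpBl /tau; lra.
split=> //.
(* Moving [(invmx A)^T] across the inner product cancels it against [A], so only the translation [b]
   contributes an extra term, which [betas i] compensates. *)
have dotA : dotp (A *m lambda i) (gammas x) =
    dotp (gamma x) (lambda i) + dotp (A *m lambda i) b.
  rewrite [LHS]dotpC {1}gammasE dotpDl [dotp b _]dotpC
    [dotp (_^T *m _) _]dotp_mulmxl trmxK.
  by rewrite mulmxA mulVmx // mul1mx.
by rewrite /ss /s /logit lambdasE betasE dotpC dotpDl dotA; lra.
Qed.
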